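(* Let $X$ be a right and left 1-closed regular poly-bicategory. Then, for a 1-cell $e: x \to y$ of $X$, the following are equivalent: 1. $e$ is tensor universal; 2. there exist tensor units $1_x$ on $x$ and $1_y$ on $y$, a 1-cell $e^*: y \to x$, and 2-cells exhibiting $e \otimes e^* \simeq 1_x$ and $e^* \otimes e \simeq 1_y$, that is, 2-cells $(e,e^* )\to(1_x)$ and $(e^*,e)\to(1_y)$ both universal at $\partial_1^+$.
   Context: A regular 2-polygraph $X$ consists of a set of 0-cells, a set of 1-cells $a: x \to y$ (each with a source and a target 0-cell), and, for all $n,m\ge 1$, a set of 2-cells $p:(a_1,\ldots,a_n)\to(b_1,\ldots,b_m)$, whose input $(a_i)$ and output $(b_j)$ are non-empty composable sequences of 1-cells (the target of each is the source of the next) with the same initial source and the same final target; write $\partial_i^-p=a_i$, $\partial_j^+p=b_j$. Greek capitals denote possibly empty composable sequences of 1-cells, and commas denote concatenation. A (non-unital) regular poly-bicategory is a regular 2-polygraph with operations $\mathrm{cut}_{j,i}$: given $t:(\Gamma)\to(\Delta_1,a,\Delta_2)$ and $s:(\Gamma_1,a,\Gamma_2)\to(\Delta)$, where the displayed $a$ is the $j$-th output of $t$ and the $i$-th input of $s$, such that ($\Gamma_1$ or $\Delta_1$ is empty) and ($\Gamma_2$ or $\Delta_2$ is empty), there is a composite 2-cell $\mathrm{cut}_{j,i}(t,s):(\Gamma_1,\Gamma,\Gamma_2)\to(\Delta_1,\Delta,\Delta_2)$. These satisfy associativity and interchange: whenever three 2-cells can be composed by two cuts, along the same two identified 1-cells,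 in two different orders, the two results are equal (e.g. $\mathrm{cut}_{j,1}(t,\mathrm{cut}_{i,1}(s,r))=\mathrm{cut}_{i+j-1,1}(\mathrm{cut}_{j,1}(t,s),r)$). No unit cells are part of the structure. Universality. A 2-cell $t:(\Gamma)\to(\Delta_1,a,\Delta_2)$, with $a$ in $j$-th position, is universal at $\partial_j^+$ if for all $\Gamma_1,\Gamma_2$ and non-empty $\Delta$ with ($\Gamma_1$ or $\Delta_1$ empty) and ($\Gamma_2$ or $\Delta_2$ empty), every 2-cell $s:(\Gamma_1,\Gamma,\Gamma_2)\to(\Delta_1,\Delta,\Delta_2)$ equals $\mathrm{cut}(t,r)$, composed along $a$, for a unique $r:(\Gamma_1,a,\Gamma_2)\to(\Delta)$. Dually, $t:(\Gamma_1,a,\Gamma_2)\to(\Delta)$, with $a$ in $i$-th position, is universal at $\partial_i^-$ if for all $\Delta_1,\Delta_2$ and non-empty $\Gamma$ with ($\Gamma_1$ or $\Delta_1$ empty) and ($\Gamma_2$ or $\Delta_2$ empty), every $s:(\Gamma_1,\Gamma,\Gamma_2)\to(\Delta_1,\Delta,\Delta_2)$ equals $\mathrm{cut}(r,t)$, composed along $a$, for a unique $r:(\Gamma)\to(\Delta_1,a,\Delta_2)$. A unit on a 1-cell $a$ is a 2-cell $\mathrm{id}_a:(a)\to(a)$ such that every cut with $\mathrm{id}_a$, on either side, returns the other 2-cell. $X$ is unital if every 1-cell has a unit. $X$ is right 1-closed if it is unital and for all 1-cells $a: x\to y$, $b: x\to z$ there exist a 1-cell $u: y\to z$ and a 2-cell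 (a right hom) $(a,u)\to(b)$ universal at $\partial_2^-$. $X$ is left 1-closed if it is unital and for all 1-cells $a: y\to z$, $b: x\to z$ there exist a 1-cell $u: x\to y$ and a 2-cell (a left hom) $(u,a)\to(b)$ universal at $\partial_1^-$. Tensor units. A 1-cell $1_x: x\to x$ is a tensor unit on $x$ if for each 1-cell $a: x\to y$ there is a 2-cell $l_a:(1_x,a)\to(a)$ universal at both $\partial_1^+$ and $\partial_2^-$, and for each 1-cell $b:z\to x$ there is a 2-cell $r_b:(b,1_x)\to(b)$ universal at both $\partial_1^+$ and $\partial_1^-$. Tensor universality. Let $e: x \to x'$ be a 1-cell. It is tensor left universal if for each 1-cell $a: x\to y$ there exist a 1-cell $u: x'\to y$ and a 2-cell $(e,u)\to(a)$ universal at both $\partial_1^+$ and $\partial_2^-$, and for each 1-cell $a':x'\to y$ there exist a 1-cell $v: x\to y$ and a 2-cell $(e,a')\to(v)$ universal at both $\partial_1^+$ and $\partial_2^-$. It is tensor right universal if for each $b': z\to x'$ there exist $u: z\to x$ and a 2-cell $(u,e)\to(b')$ universal at both $\partial_1^+$ and $\partial_1^-$, and for each $b:z\to x$ there exist $v: z\to x'$ and a 2-cell $(b,e)\to(v)$ universal at both $\partial_1^+$ and $\partial_1^-$. It is tensor universal if it is both tensor left and tensor right universal. *)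

(* Defs.v *)
From mathcomp Require Import all_boot.

Set Implicit Arguments.
Unset Strict Implicit.
Unset Printing Implicit Defensive.

(* 1-cells form one type with source and target maps, so that composable
   sequences are plain sequences satisfying [composable] and the commas of the
   usual notation are [++].  A 2-cell can exist only on a boundary made of
   non-empty composable parallel sequences: this is [cell2_boundary]. *)
Fixpoint composable (C0 C1 : Type) (src tgt : C1 -> C0)
    (x : C0) (Γ : seq C1) (y : C0) : Prop :=
  if Γ is a :: Γ' then src a = x /\ composable src tgt (tgt a) Γ' y else x = y.

Record polygraph2 := Polygraph2 {
  cell0 : Type;
  cell1 : Type;
  src : cell1 -> cell0;
  tgt : cell1 -> cell0;
  cell2 : seq cell1 -> seq cell1 -> Type;
  cell2_boundary : forall Γ Δ, cell2 Γ Δ ->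
    [/\ ~~ nilp Γ, ~~ nilp Δ &
      exists x y, composable src tgt x Γ y /\ composable src tgt x Δ y]
}.

Definition arrow (X : polygraph2) (a : cell1 X) (x y : cell0 X) : Prop :=
  src a = x /\ tgt a = y.

(* Equality of 2-cells together with their boundaries.  It is needed when the
   boundaries are provably but not definitionally equal, as for
   [Γ ++ [::]] and [Γ]. *)
Definition pack (X : polygraph2) (Γ Δ : seq (cell1 X)) (t : cell2 Γ Δ) :
    {b : seq (cell1 X) * seq (cell1 X) & cell2 b.1 b.2} :=
  existT (fun b : seq (cell1 X) * seq (cell1 X) => cell2 b.1 b.2) (Γ, Δ) t.

Definition same2 (X : polygraph2) (Γ Δ Γ' Δ' : seq (cell1 X))
    (t : cell2 Γ Δ) (t' : cell2 Γ' Δ') : Prop := pack t = pack t'.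

Notation "t ≡₂ t'" := (same2 t t') (at level 70, no associativity).

(* Boolean, so that [cut] below cannot depend on how the condition is proved. *)
Definition planar (T : Type) (Γ Δ : seq T) : bool := nilp Γ || nilp Δ.

(* In [cut _ _ t s] the lists [Δ1] and [Γ1] determine the positions
   j = size Δ1 + 1 and i = size Γ1 + 1 of cut_{j,i}.
   Three 2-cells joined by two cuts form either a chain, or a fork below the
   common source of the two 1-cells, or a fork above their common target;
   this gives the three laws, each assumed exactly when all four cuts exist.
   [u] and [v] are the intermediate composites; [t'] and [r'] are the branching
   cell, its boundary being split around the other 1-cell. *)
Record poly_bicategory := PolyBicategory {
  pb_polygraph :> polygraph2;
  cut : forall {Γ Γ1 Γ2 Δ Δ1 Δ2 : seq (cell1 pb_polygraph)}
               {a : cell1 pb_polygraph},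
    planar Γ1 Δ1 -> planar Γ2 Δ2 ->
    cell2 Γ (Δ1 ++ a :: Δ2) -> cell2 (Γ1 ++ a :: Γ2) Δ ->
    cell2 (Γ1 ++ Γ ++ Γ2) (Δ1 ++ Δ ++ Δ2);
  cut_chain : forall (Γ Γ1 Γ2 Γ1' Γ2' Δ1 Δ2 Δ1' Δ2' Δ' : seq (cell1 pb_polygraph))
      (a b : cell1 pb_polygraph)
      (t : cell2 Γ (Δ1 ++ a :: Δ2))
      (s : cell2 (Γ1 ++ a :: Γ2) (Δ1' ++ b :: Δ2'))
      (r : cell2 (Γ1' ++ b :: Γ2') Δ')
      (ts1 : planar Γ1 Δ1) (ts2 : planar Γ2 Δ2)
      (ur1 : planar Γ1' (Δ1 ++ Δ1')) (ur2 : planar Γ2' (Δ2' ++ Δ2))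
      (sr1 : planar Γ1' Δ1') (sr2 : planar Γ2' Δ2')
      (tv1 : planar (Γ1' ++ Γ1) Δ1) (tv2 : planar (Γ2 ++ Γ2') Δ2)
      (u : cell2 (Γ1 ++ Γ ++ Γ2) ((Δ1 ++ Δ1') ++ b :: (Δ2' ++ Δ2)))
      (v : cell2 ((Γ1' ++ Γ1) ++ a :: (Γ2 ++ Γ2')) (Δ1' ++ Δ' ++ Δ2')),
    u ≡₂ cut ts1 ts2 t s -> v ≡₂ cut sr1 sr2 s r ->
    cut ur1 ur2 u r ≡₂ cut tv1 tv2 t v;
  cut_fork_out : forall (Γ Γ1 Γ2 Γ1' Γ2' Δ1 Δ2 Δ3 Δ Δ' : seq (cell1 pb_polygraph))
      (a b : cell1 pb_polygraph)
      (t : cell2 Γ (Δ1 ++ a :: (Δ2 ++ b :: Δ3)))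
      (t' : cell2 Γ ((Δ1 ++ a :: Δ2) ++ b :: Δ3))
      (s : cell2 (Γ1 ++ a :: Γ2) Δ)
      (r : cell2 (Γ1' ++ b :: Γ2') Δ')
      (ts1 : planar Γ1 Δ1) (ts2 : planar Γ2 (Δ2 ++ b :: Δ3))
      (ur1 : planar Γ1' (Δ1 ++ Δ ++ Δ2)) (ur2 : planar Γ2' Δ3)
      (tr1 : planar Γ1' (Δ1 ++ a :: Δ2)) (tr2 : planar Γ2' Δ3)
      (vs1 : planar Γ1 Δ1) (vs2 : planar Γ2 (Δ2 ++ Δ' ++ Δ3))
      (u : cell2 (Γ1 ++ Γ ++ Γ2) ((Δ1 ++ Δ ++ Δ2) ++ b :: Δ3))
      (v : cell2 (Γ1' ++ Γ ++ Γ2') (Δ1 ++ a :: (Δ2 ++ Δ' ++ Δ3))),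
    t' ≡₂ t -> u ≡₂ cut ts1 ts2 t s -> v ≡₂ cut tr1 tr2 t' r ->
    cut ur1 ur2 u r ≡₂ cut vs1 vs2 v s;
  cut_fork_in : forall (Γ Γ' Γ1 Γ2 Γ3 Δ Δ1 Δ2 Δ1' Δ2' : seq (cell1 pb_polygraph))
      (a b : cell1 pb_polygraph)
      (r : cell2 (Γ1 ++ a :: (Γ2 ++ b :: Γ3)) Δ)
      (r' : cell2 ((Γ1 ++ a :: Γ2) ++ b :: Γ3) Δ)
      (t : cell2 Γ (Δ1 ++ a :: Δ2))
      (s : cell2 Γ' (Δ1' ++ b :: Δ2'))
      (tr1 : planar Γ1 Δ1) (tr2 : planar (Γ2 ++ b :: Γ3) Δ2)
      (su1 : planar (Γ1 ++ Γ ++ Γ2) Δ1') (su2 : planar Γ3 Δ2')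
      (sr1 : planar (Γ1 ++ a :: Γ2) Δ1') (sr2 : planar Γ3 Δ2')
      (tv1 : planar Γ1 Δ1) (tv2 : planar (Γ2 ++ Γ' ++ Γ3) Δ2)
      (u : cell2 ((Γ1 ++ Γ ++ Γ2) ++ b :: Γ3) (Δ1 ++ Δ ++ Δ2))
      (v : cell2 (Γ1 ++ a :: (Γ2 ++ Γ' ++ Γ3)) (Δ1' ++ Δ ++ Δ2')),
    r' ≡₂ r -> u ≡₂ cut tr1 tr2 t r -> v ≡₂ cut sr1 sr2 s r' ->
    cut su1 su2 s u ≡₂ cut tv1 tv2 t v
}.

Section Notions.

Variable X : poly_bicategory.
Implicit Types (Γ Δ : seq (cell1 X)) (a b e i u v : cell1 X) (x y z : cell0 X).

(* [universal_out Δ1 a Δ2 t]: t is universal at its output a, in position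
   size Δ1 + 1; similarly for [universal_in] with inputs. *)
Definition universal_out Γ Δ1 a Δ2 (t : cell2 Γ (Δ1 ++ a :: Δ2)) : Prop :=
  forall Γ1 Γ2 Δ (h1 : planar Γ1 Δ1) (h2 : planar Γ2 Δ2), ~~ nilp Δ ->
  forall s : cell2 (Γ1 ++ Γ ++ Γ2) (Δ1 ++ Δ ++ Δ2),
  exists! r : cell2 (Γ1 ++ a :: Γ2) Δ, s = cut h1 h2 t r.

Definition universal_in Δ Γ1 a Γ2 (t : cell2 (Γ1 ++ a :: Γ2) Δ) : Prop :=
  forall Δ1 Δ2 Γ (h1 : planar Γ1 Δ1) (h2 : planar Γ2 Δ2), ~~ nilp Γ ->
  forall s : cell2 (Γ1 ++ Γ ++ Γ2) (Δ1 ++ Δ ++ Δ2),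
  exists! r : cell2 Γ (Δ1 ++ a :: Δ2), s = cut h1 h2 r t.

Definition is_unit a (ida : cell2 [:: a] [:: a]) : Prop :=
  (forall Γ1 Γ2 Δ (h1 : planar Γ1 [::]) (h2 : planar Γ2 [::])
          (s : cell2 (Γ1 ++ a :: Γ2) Δ),
     @cut X [:: a] Γ1 Γ2 Δ [::] [::] a h1 h2 ida s ≡₂ s) /\
  (forall Γ Δ1 Δ2 (h1 : planar [::] Δ1) (h2 : planar [::] Δ2)
          (t : cell2 Γ (Δ1 ++ a :: Δ2)),
     @cut X Γ [::] [::] [:: a] Δ1 Δ2 a h1 h2 t ida ≡₂ t).

Definition unital : Prop :=
  forall a, exists ida : cell2 [:: a] [:: a], is_unit ida.

Definition right_1closed : Prop :=
  unital /\
  forall x y z a b, arrow a x y -> arrow b x z ->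
  exists (u : cell1 X) (t : cell2 [:: a; u] [:: b]),
    arrow u y z /\ @universal_in [:: b] [:: a] u [::] t.

Definition left_1closed : Prop :=
  unital /\
  forall x y z a b, arrow a y z -> arrow b x z ->
  exists (u : cell1 X) (t : cell2 [:: u; a] [:: b]),
    arrow u x y /\ @universal_in [:: b] [::] u [:: a] t.

(* 2-cells (e,u) -> (a) universal at the output and at the second,
   respectively the first, input. *)
Definition left_div e u a (t : cell2 [:: e; u] [:: a]) : Prop :=
  @universal_out [:: e; u] [::] a [::] t /\ @universal_in [:: a] [:: e] u [::] t.

Definition right_div u e a (t : cell2 [:: u; e] [:: a]) : Prop :=
  @universal_out [:: u; e] [::] a [::] t /\ @universal_in [:: a] [::] u [:: e] t.

Definition tensor_unit x i : Prop :=
  [/\ arrow i x x,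
      (forall y a, arrow a x y -> exists l : cell2 [:: i; a] [:: a], left_div l) &
      (forall z b, arrow b z x -> exists r : cell2 [:: b; i] [:: b], right_div r)].

Definition tensor_left_universal e : Prop :=
  (forall y a, arrow a (src e) y ->
     exists (u : cell1 X) (t : cell2 [:: e; u] [:: a]),
       arrow u (tgt e) y /\ left_div t) /\
  (forall y a, arrow a (tgt e) y ->
     exists (v : cell1 X) (t : cell2 [:: e; a] [:: v]),
       arrow v (src e) y /\ left_div t).

Definition tensor_right_universal e : Prop :=
  (forall z b, arrow b z (tgt e) ->
     exists (u : cell1 X) (t : cell2 [:: u; e] [:: b]),
       arrow u z (src e) /\ right_div t) /\
  (forall z b, arrow b z (src e) ->
     exists (v : cell1 X) (t : cell2 [:: b; e] [:: v]),
       arrow v z (tgt e) /\ right_div t).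

Definition tensor_universal e : Prop :=
  tensor_left_universal e /\ tensor_right_universal e.

End Notions.

Arguments right_1closed X : clear implicits.
Arguments left_1closed X : clear implicits.

(* Main.v *)
Require Import Defs.
From mathcomp Require Import all_boot.
From Stdlib Require Import ClassicalEpsilon Eqdep.

Set Implicit Arguments.
Unset Strict Implicit.
Unset Printing Implicit Defensive.

(** Read a cell [t : Γ -> a] that is universal at its only output as a tensor
    of [Γ]: precomposition with [t] is a bijection between the cells having
    [a] among their inputs and those having [Γ] there. Such cells compose and
    cancel like equivalences ([uout_comp], [uout_cancel]), and so do the cells
    universal at their last input ([uin_comp], [uin_cancel], [uin_pre],
    [uin_pre_cancel]).

    Suppose first that [e] has a weak inverse [e'], with [p : e,e' -> 1_x] and
    [q : e',e -> 1_y] universal at their outputs. Right closedness provides,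
    for every [a] out of [x], a right hom [t : e,u -> a], and it remains to
    see that [t] is universal at its output ([uout_of_uin]). Since [e,e',a ->
    1_x,a -> a] is universal at its output and factors through [t] as [w :
    e',a -> u], it is enough that [w] can be cancelled. The composite [e',e,u
    -> e',a -> u] of [t] and [w] differs from [e',e,u -> 1_y,u -> u] by an
    endocell [h] of [u], which need not be the identity: no triangle identity
    relates [p] and [q]. Nevertheless [h] is invertible enough, by comparison
    of the universal properties at [u] of cells [e,e',e,u -> a]. The second
    half of tensor left universality, a division cell out of [(e, a)], is
    obtained by transposing [e',e,a -> a] across a right hom [e',v -> a]
    ([uin_transpose]).

    Suppose conversely that [e] is tensor universal. Dividing [e] by itself
    gives [ρ : e,i -> e]. For every [a] out of [y], the universal cell [e,a ->
    v] turns [ρ] into a cell [l_a : i,a -> a]; for every [b] into [y], the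
    universal cell [u,e -> b] turns [ρ] into [r_b : b,i -> b]. The
    construction makes [l_a] universal at its input [a] and [r_b] universal at
    its output. Both families are natural, so cutting a cell with [l] at an
    input or at an output gives the same result, and one universal property
    transfers to the other ([lunitor_natural], [runitor_natural],
    [tunit_of_runitor_cell]). Hence [i] is a tensor unit; the dual argument
    gives one on [x]. Dividing these units by [e] on either side produces a
    right and a left inverse of [e], which agree as for monoids
    ([uout_inverse]).

    All of this is invariant under reversal of sequences, which exchanges left
    and right. To use this symmetry, and to keep associativity of
    concatenation out of the types of cells, 2-cells are bundled with their
    boundary and [cut] is made a total function on bundled cells. *)

(** * Poly-bicategories with bundled cells *)

(** The cells of all boundaries form one type, and [comp] is total: its laws
    assert nothing unless the boundaries match.  Thus every law is an equation
    in a fixed type whatever bracketing its boundary lists have. *)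
Record flat_poly := FlatPoly {
  obj : Type;
  edge : Type;
  esrc : edge -> obj;
  etgt : edge -> obj;
  cell : Type;
  dom : cell -> seq edge;
  cod : cell -> seq edge;
  comp : seq edge -> seq edge -> seq edge -> seq edge -> cell -> cell -> cell;
  cell_boundary : forall c, [/\ ~~ nilp (dom c), ~~ nilp (cod c) &
    exists x y, composable esrc etgt x (dom c) y /\
                composable esrc etgt x (cod c) y];
  comp_boundary : forall Γ1 Γ2 Δ1 Δ2 a t s,
    cod t = Δ1 ++ a :: Δ2 -> dom s = Γ1 ++ a :: Γ2 ->
    planar Γ1 Δ1 -> planar Γ2 Δ2 ->
    dom (comp Γ1 Γ2 Δ1 Δ2 t s) = Γ1 ++ dom t ++ Γ2 /\
    cod (comp Γ1 Γ2 Δ1 Δ2 t s) = Δ1 ++ cod s ++ Δ2;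
  comp_chain : forall Γ1 Γ2 Γ1' Γ2' Δ1 Δ2 Δ1' Δ2' a b t s r,
    cod t = Δ1 ++ a :: Δ2 -> dom s = Γ1 ++ a :: Γ2 ->
    cod s = Δ1' ++ b :: Δ2' -> dom r = Γ1' ++ b :: Γ2' ->
    planar Γ1 Δ1 -> planar Γ2 Δ2 -> planar Γ1' Δ1' -> planar Γ2' Δ2' ->
    planar Γ1' (Δ1 ++ Δ1') -> planar Γ2' (Δ2' ++ Δ2) ->
    planar (Γ1' ++ Γ1) Δ1 -> planar (Γ2 ++ Γ2') Δ2 ->
    comp Γ1' Γ2' (Δ1 ++ Δ1') (Δ2' ++ Δ2) (comp Γ1 Γ2 Δ1 Δ2 t s) r =
    comp (Γ1' ++ Γ1) (Γ2 ++ Γ2') Δ1 Δ2 t (comp Γ1' Γ2' Δ1' Δ2' s r);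
  comp_fork : forall Γ1 Γ2 Γ3 Δ1 Δ2 Δ1' Δ2' a b t s r,
    dom r = Γ1 ++ a :: Γ2 ++ b :: Γ3 ->
    cod t = Δ1 ++ a :: Δ2 -> cod s = Δ1' ++ b :: Δ2' ->
    planar Γ1 Δ1 -> planar (Γ2 ++ b :: Γ3) Δ2 ->
    planar (Γ1 ++ dom t ++ Γ2) Δ1' -> planar Γ3 Δ2' ->
    planar (Γ1 ++ a :: Γ2) Δ1' -> planar (Γ2 ++ dom s ++ Γ3) Δ2 ->
    comp (Γ1 ++ dom t ++ Γ2) Γ3 Δ1' Δ2' s
      (comp Γ1 (Γ2 ++ b :: Γ3) Δ1 Δ2 t r) =
    comp Γ1 (Γ2 ++ dom s ++ Γ3) Δ1 Δ2 t
      (comp (Γ1 ++ a :: Γ2) Γ3 Δ1' Δ2' s r)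
}.

Lemma planar0r T (Γ : seq T) : planar Γ [::].
Proof. by rewrite /planar orbT. Qed.

Lemma planar_rev T (Γ Δ : seq T) : planar (rev Γ) (rev Δ) = planar Γ Δ.
Proof. by rewrite /planar /nilp !size_rev. Qed.

Section Flat.

Variable M : flat_poly.
Implicit Types (Γ Δ : seq (edge M)) (a b d e g i u v : edge M) (t s r c : cell M).

Definition has t Γ Δ := dom t = Γ /\ cod t = Δ.
(** When the upper cell has a single output, planarity holds automatically. *)
Definition pre Γ1 Γ2 t s := comp Γ1 Γ2 [::] [::] t s.

Lemma has_comp Γ Γ1 Γ2 Δ Δ1 Δ2 a t s :
  has t Γ (Δ1 ++ a :: Δ2) -> has s (Γ1 ++ a :: Γ2) Δ ->
  planar Γ1 Δ1 -> planar Γ2 Δ2 ->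
  has (comp Γ1 Γ2 Δ1 Δ2 t s) (Γ1 ++ Γ ++ Γ2) (Δ1 ++ Δ ++ Δ2).
Proof.
by move=> [<- ct] [ds <-] h1 h2; exact: comp_boundary ct ds h1 h2.
Qed.

Lemma has_pre Γ Γ1 Γ2 Δ a t s :
  has t Γ [:: a] -> has s (Γ1 ++ a :: Γ2) Δ ->
  has (pre Γ1 Γ2 t s) (Γ1 ++ Γ ++ Γ2) Δ.
Proof.
move=> ht hs.
have := @has_comp Γ Γ1 Γ2 Δ [::] [::] a t s ht hs (planar0r _) (planar0r _).
by rewrite /= cats0.
Qed.

Lemma comp_pre Γ Γ1 Γ2 Γ1' Γ2' Δ Δ1 Δ2 a b t s r :
  has t Γ [:: a] -> has s (Γ1 ++ a :: Γ2) (Δ1 ++ b :: Δ2) ->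
  has r (Γ1' ++ b :: Γ2') Δ -> planar Γ1' Δ1 -> planar Γ2' Δ2 ->
  comp Γ1' Γ2' Δ1 Δ2 (pre Γ1 Γ2 t s) r =
  pre (Γ1' ++ Γ1) (Γ2 ++ Γ2') t (comp Γ1' Γ2' Δ1 Δ2 s r).
Proof.
move=> [_ ct] [ds cs] [dr _] h1 h2.
have := @comp_chain M Γ1 Γ2 Γ1' Γ2' [::] [::] Δ1 Δ2 a b t s r ct ds cs dr.
by rewrite cats0; apply=> //; exact: planar0r.
Qed.

Lemma pre_pre Γ Γ1 Γ2 Γ1' Γ2' Δ a b t s r :
  has t Γ [:: a] -> has s (Γ1 ++ a :: Γ2) [:: b] -> has r (Γ1' ++ b :: Γ2') Δ ->
  pre Γ1' Γ2' (pre Γ1 Γ2 t s) r = pre (Γ1' ++ Γ1) (Γ2 ++ Γ2') t (pre Γ1' Γ2' s r).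
Proof.
move=> ht hs hr.
exact: (comp_pre (Δ1 := [::]) (Δ2 := [::]) ht hs hr (planar0r _) (planar0r _)).
Qed.

Lemma comp_comp Γ Γ1 Γ2 Γ1' Γ2' Δ Δ1 Δ2 a b t s r :
  has t Γ (Δ1 ++ a :: Δ2) -> has s (Γ1 ++ a :: Γ2) [:: b] ->
  has r (Γ1' ++ b :: Γ2') Δ ->
  planar (Γ1' ++ Γ1) Δ1 -> planar (Γ2 ++ Γ2') Δ2 ->
  comp Γ1' Γ2' Δ1 Δ2 (comp Γ1 Γ2 Δ1 Δ2 t s) r =
  comp (Γ1' ++ Γ1) (Γ2 ++ Γ2') Δ1 Δ2 t (pre Γ1' Γ2' s r).
Proof.
move=> [_ ct] [ds cs] [dr _] h1 h2.
have := @comp_chain M Γ1 Γ2 Γ1' Γ2' Δ1 Δ2 [::] [::] a b t s r ct ds cs dr.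
have [h11 h12] : planar Γ1 Δ1 /\ planar Γ1' Δ1.
  by move: h1; rewrite /planar; case: (Γ1'); case: (Γ1); case: (Δ1).
have [h21 h22] : planar Γ2 Δ2 /\ planar Γ2' Δ2.
  by move: h2; rewrite /planar; case: (Γ2'); case: (Γ2); case: (Δ2).
by rewrite cats0; apply=> //; exact: planar0r.
Qed.

Lemma pre_fork_l Γt Γs Γ1 Γ2 Γ3 Δ D a b t s r :
  has t Γt [:: a] -> has s Γs (b :: D) -> has r (Γ1 ++ a :: Γ2 ++ b :: Γ3) Δ ->
  planar Γ3 D ->
  comp (Γ1 ++ Γt ++ Γ2) Γ3 [::] D s (pre Γ1 (Γ2 ++ b :: Γ3) t r) =
  pre Γ1 (Γ2 ++ Γs ++ Γ3) t (comp (Γ1 ++ a :: Γ2) Γ3 [::] D s r).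
Proof.
move=> [<- ct] [<- cs] [dr _] h.
by apply: (@comp_fork M Γ1 Γ2 Γ3 [::] [::] [::] D a b) => //; exact: planar0r.
Qed.

Lemma pre_fork_r Γt Γs Γ1 Γ2 Γ3 Δ D a b t s r :
  has t Γt (D ++ [:: a]) -> has s Γs [:: b] ->
  has r (Γ1 ++ a :: Γ2 ++ b :: Γ3) Δ ->
  planar Γ1 D ->
  pre (Γ1 ++ Γt ++ Γ2) Γ3 s (comp Γ1 (Γ2 ++ b :: Γ3) D [::] t r) =
  comp Γ1 (Γ2 ++ Γs ++ Γ3) D [::] t (pre (Γ1 ++ a :: Γ2) Γ3 s r).
Proof.
move=> [<- ct] [<- cs] [dr _] h.
by apply: (@comp_fork M Γ1 Γ2 Γ3 D [::] [::] [::] a b) => //; exact: planar0r.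
Qed.

(** * Cells universal at their output *)

Definition epi a t := forall Γ1 Γ2 Δ r r',
  has r (Γ1 ++ a :: Γ2) Δ -> has r' (Γ1 ++ a :: Γ2) Δ ->
  pre Γ1 Γ2 t r = pre Γ1 Γ2 t r' -> r = r'.

Definition uout Γ a t := [/\ has t Γ [:: a], epi a t &
  forall Γ1 Γ2 Δ s, has s (Γ1 ++ Γ ++ Γ2) Δ ->
    exists2 r, has r (Γ1 ++ a :: Γ2) Δ & pre Γ1 Γ2 t r = s].

(** The universal property at the input [a] in position [size Γ1 + 1].  A
    non-empty [Γ1] forces [Δ1] to be empty, and likewise on the right. *)
Definition uin Γ1 a Γ2 b t := [/\ has t (Γ1 ++ a :: Γ2) [:: b],
  forall Δ1 Δ2 Γ r r', planar Γ1 Δ1 -> planar Γ2 Δ2 ->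
    has r Γ (Δ1 ++ a :: Δ2) -> has r' Γ (Δ1 ++ a :: Δ2) ->
    comp Γ1 Γ2 Δ1 Δ2 r t = comp Γ1 Γ2 Δ1 Δ2 r' t -> r = r' &
  forall Δ1 Δ2 Γ s, planar Γ1 Δ1 -> planar Γ2 Δ2 -> ~~ nilp Γ ->
    has s (Γ1 ++ Γ ++ Γ2) (Δ1 ++ b :: Δ2) ->
    exists2 r, has r Γ (Δ1 ++ a :: Δ2) & comp Γ1 Γ2 Δ1 Δ2 r t = s].

Definition ldiv e u a t := uout [:: e; u] a t /\ uin [:: e] u [::] a t.
Definition rdiv u e a t := uout [:: u; e] a t /\ uin [::] u [:: e] a t.

Definition funital := forall a, exists2 i, has i [:: a] [:: a] &
  (forall Γ1 Γ2 Δ s, has s (Γ1 ++ a :: Γ2) Δ -> pre Γ1 Γ2 i s = s) /\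
  (forall Γ Δ1 Δ2 t, has t Γ (Δ1 ++ a :: Δ2) ->
     comp [::] [::] Δ1 Δ2 t i = t).

Definition rclosed := forall a b, esrc a = esrc b ->
  exists u t, [/\ esrc u = etgt a, etgt u = etgt b & uin [:: a] u [::] b t].

Definition tunit x i := [/\ esrc i = x, etgt i = x,
  forall a, esrc a = x -> exists l, ldiv i a a l &
  forall b, etgt b = x -> exists r, rdiv b i b r].

Lemma epi_comp Γ Γ1 Γ2 a b t s :
  has t Γ [:: a] -> has s (Γ1 ++ a :: Γ2) [:: b] ->
  epi a t -> epi b s -> epi b (pre Γ1 Γ2 t s).
Proof.
move=> ht hs et es Γ1' Γ2' Δ r r' hr hr'.
rewrite (pre_pre ht hs hr) (pre_pre ht hs hr') => E.
apply: (es _ _ _ _ _ hr hr'); apply: (et _ _ Δ _ _ _ _ E).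
- by have := has_pre hs hr; rewrite -!catA.
- by have := has_pre hs hr'; rewrite -!catA.
Qed.

Lemma epi_cancel Γ Γ1 Γ2 a b t s :
  has t Γ [:: a] -> has s (Γ1 ++ a :: Γ2) [:: b] ->
  epi b (pre Γ1 Γ2 t s) -> epi b s.
Proof.
move=> ht hs ets Γ1' Γ2' Δ r r' hr hr' E; apply: (ets _ _ _ _ _ hr hr').
by rewrite (pre_pre ht hs hr) (pre_pre ht hs hr') E.
Qed.

Lemma uout_comp Γ Γ1 Γ2 a b t s :
  uout Γ a t -> uout (Γ1 ++ a :: Γ2) b s ->
  uout (Γ1 ++ Γ ++ Γ2) b (pre Γ1 Γ2 t s).
Proof.
move=> [ht et st] [hs es ss]; split; [exact: has_pre ht hs|exact: epi_comp ht hs et es|].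
move=> Γ1' Γ2' Δ c hc.
have [|r1 hr1 E1] := st (Γ1' ++ Γ1) (Γ2 ++ Γ2') Δ c.
  by move: hc; rewrite -!catA.
have [|r2 hr2 E2] := ss Γ1' Γ2' Δ r1; first by move: hr1; rewrite -!catA.
by exists r2 => //; rewrite (pre_pre ht hs hr2) E2.
Qed.

(** Cancellability of [t] suffices, and it is all that is known of the first
    factor when this is used to show that a right hom is universal. *)
Lemma uout_cancel Γ Γ1 Γ2 a b t s :
  has t Γ [:: a] -> has s (Γ1 ++ a :: Γ2) [:: b] -> epi a t ->
  uout (Γ1 ++ Γ ++ Γ2) b (pre Γ1 Γ2 t s) -> uout (Γ1 ++ a :: Γ2) b s.
Proof.
move=> ht hs et [_ es ss]; split=> //; first exact: epi_cancel ht hs es.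
move=> Γ1' Γ2' Δ c hc.
have hc' : has c ((Γ1' ++ Γ1) ++ a :: (Γ2 ++ Γ2')) Δ.
  by move: hc; rewrite -!catA.
have [|r hr E] := ss Γ1' Γ2' Δ (pre (Γ1' ++ Γ1) (Γ2 ++ Γ2') t c).
  by have := has_pre ht hc'; rewrite -!catA.
exists r => //; apply: (et _ _ _ _ _ _ hc').
  by have := has_pre hs hr; rewrite -!catA.
by rewrite -E (pre_pre ht hs hr).
Qed.

(** * Cells universal at their last input *)

(** With inputs to the left of [a] and none to its right, planarity leaves only
    outputs to the right of the output cut along. *)
Lemma uin_last Γ a b t : ~~ nilp Γ -> has t (Γ ++ [:: a]) [:: b] ->
  (forall D Γ' r r', has r Γ' (a :: D) -> has r' Γ' (a :: D) ->
    comp Γ [::] [::] D r t = comp Γ [::] [::] D r' t -> r = r') ->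
  (forall D Γ' s, ~~ nilp Γ' -> has s (Γ ++ Γ') (b :: D) ->
    exists2 r, has r Γ' (a :: D) & comp Γ [::] [::] D r t = s) ->
  uin Γ a [::] b t.
Proof.
move=> nΓ ht it st; split=> // -[|d Δ1] Δ2 Γ'; rewrite /planar /= ?orbF.
- by move=> r r' _ _; apply: it.
- by rewrite (negbTE nΓ).
- by move=> s _ _ nΓ' hs; apply: st => //; move: hs; rewrite cats0.
- by rewrite (negbTE nΓ).
Qed.

Lemma uin_last_inj Γ a b t : uin Γ a [::] b t ->
  forall D Γ' r r', has r Γ' (a :: D) -> has r' Γ' (a :: D) ->
    comp Γ [::] [::] D r t = comp Γ [::] [::] D r' t -> r = r'.
Proof.
by move=> [_ it _] D Γ' r r'; apply: (it [::] D) => //; exact: planar0r.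
Qed.

Lemma uin_last_ex Γ a b t : uin Γ a [::] b t ->
  forall D Γ' s, ~~ nilp Γ' -> has s (Γ ++ Γ') (b :: D) ->
    exists2 r, has r Γ' (a :: D) & comp Γ [::] [::] D r t = s.
Proof.
move=> [_ _ st] D Γ' s nΓ' hs; apply: (st [::] D) => //; first exact: planar0r.
by rewrite !cats0.
Qed.

Lemma has_last Γ Γ' D a b t s : has t (Γ ++ [:: a]) [:: b] -> has s Γ' (a :: D) ->
  has (comp Γ [::] [::] D s t) (Γ ++ Γ') (b :: D).
Proof.
move=> ht hs; have := has_comp (Δ1 := [::]) hs ht (planar0r _) isT.
by rewrite !cats0.
Qed.

Lemma nilp_dom c Γ Δ : has c Γ Δ -> ~~ nilp Γ.
Proof. by move=> [<- _]; case: (cell_boundary c). Qed.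

Lemma uin_comp Γ Γ' a b d t s : ~~ nilp Γ' ->
  uin Γ a [::] b t -> uin Γ' b [::] d s ->
  uin (Γ' ++ Γ) a [::] d (pre Γ' [::] t s).
Proof.
move=> nΓ' ut us; have [ht _ _] := ut; have [hs _ _] := us.
have E D Γ'' r : has r Γ'' (a :: D) ->
   comp Γ' [::] [::] D (comp Γ [::] [::] D r t) s =
   comp (Γ' ++ Γ) [::] [::] D r (pre Γ' [::] t s).
  by move=> hr; apply: (comp_comp (Δ1 := [::]) hr ht hs) => //; exact: planar0r.
apply: uin_last.
- by move: nΓ'; case: (Γ').
- by have := has_pre ht hs; rewrite cats0 catA.
- move=> D Γ'' r r' hr hr'; rewrite -!(E _ Γ'') // => F.
  apply: (uin_last_inj ut hr hr'); apply: (uin_last_inj us _ _ F).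
  + exact: has_last ht hr.
  + exact: has_last ht hr'.
- move=> D Γ'' c nΓ'' hc.
  have [||r1 hr1 E1] := uin_last_ex us (Γ' := Γ ++ Γ'') (D := D) (s := c).
  + by move: nΓ''; case: (Γ'') => //= ? ?; case: (Γ).
  + by rewrite catA.
  have [r2 hr2 E2] := uin_last_ex ut nΓ'' hr1.
  by exists r2 => //; rewrite -(E _ _ _ hr2) E2.
Qed.

Lemma uin_cancel Γ Γ' a b d t s : ~~ nilp Γ ->
  has t (Γ ++ [:: a]) [:: b] -> uin Γ' b [::] d s ->
  uin (Γ' ++ Γ) a [::] d (pre Γ' [::] t s) -> uin Γ a [::] b t.
Proof.
move=> nΓ ht us ut; have [hs _ _] := us.
have E D Γ'' r : has r Γ'' (a :: D) ->
   comp Γ' [::] [::] D (comp Γ [::] [::] D r t) s =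
   comp (Γ' ++ Γ) [::] [::] D r (pre Γ' [::] t s).
  by move=> hr; apply: (comp_comp (Δ1 := [::]) hr ht hs) => //; exact: planar0r.
apply: uin_last => //.
- move=> D Γ'' r r' hr hr' F; apply: (uin_last_inj ut hr hr').
  by rewrite -!(E _ Γ'') // F.
- move=> D Γ'' c nΓ'' hc.
  have [|r hr F] := uin_last_ex ut nΓ'' (D := D) (s := comp Γ' [::] [::] D c s).
    by rewrite -catA; apply: has_last hs hc.
  exists r => //; apply: (uin_last_inj us _ hc); first exact: has_last ht hr.
  by rewrite (E _ Γ'').
Qed.

(** Precomposing another input with a cell universal at its output is bijective
    on cells and commutes with cutting at [u], so it neither creates nor
    destroys universality at [u]. *)
Lemma uin_pre Γ1 Γ Γ2 a u b t s :
  uout Γ a t -> uin (Γ1 ++ a :: Γ2) u [::] b s ->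
  uin (Γ1 ++ Γ ++ Γ2) u [::] b (pre Γ1 (Γ2 ++ [:: u]) t s).
Proof.
move=> [ht et st] us; have [hs _ _] := us.
have hs' : has s (Γ1 ++ a :: Γ2 ++ [:: u]) [:: b] by move: hs; rewrite -catA.
have E D Γ'' r : has r Γ'' (u :: D) ->
   comp (Γ1 ++ Γ ++ Γ2) [::] [::] D r (pre Γ1 (Γ2 ++ [:: u]) t s) =
   pre Γ1 (Γ2 ++ Γ'') t (comp (Γ1 ++ a :: Γ2) [::] [::] D r s).
  by move=> hr; have := pre_fork_l ht hr hs' isT; rewrite cats0.
apply: uin_last.
- by move: (nilp_dom ht); case: (Γ) => // ? ?; case: (Γ1).
- by have := has_pre ht hs'; rewrite -!catA.
- move=> D Γ'' r r' hr hr'; rewrite !(E _ Γ'') // => F.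
  apply: (uin_last_inj us hr hr'); apply: (et _ _ (b :: D) _ _ _ _ F).
  + by have := has_last hs hr; rewrite -catA.
  + by have := has_last hs hr'; rewrite -catA.
- move=> D Γ'' c nΓ'' hc.
  have [|r1 hr1 E1] := st Γ1 (Γ2 ++ Γ'') (b :: D) c.
    by move: hc; rewrite -!catA.
  have [||r2 hr2 E2] := uin_last_ex us (D := D) (Γ' := Γ'') (s := r1) => //.
    by rewrite -catA.
  by exists r2 => //; rewrite (E _ Γ'') // E2.
Qed.

Lemma uin_pre_cancel Γ1 Γ Γ2 a u b t s :
  uout Γ a t -> has s ((Γ1 ++ a :: Γ2) ++ [:: u]) [:: b] ->
  uin (Γ1 ++ Γ ++ Γ2) u [::] b (pre Γ1 (Γ2 ++ [:: u]) t s) ->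
  uin (Γ1 ++ a :: Γ2) u [::] b s.
Proof.
move=> [ht et st] hs us.
have hs' : has s (Γ1 ++ a :: Γ2 ++ [:: u]) [:: b] by move: hs; rewrite -catA.
have E D Γ'' r : has r Γ'' (u :: D) ->
   comp (Γ1 ++ Γ ++ Γ2) [::] [::] D r (pre Γ1 (Γ2 ++ [:: u]) t s) =
   pre Γ1 (Γ2 ++ Γ'') t (comp (Γ1 ++ a :: Γ2) [::] [::] D r s).
  by move=> hr; have := pre_fork_l ht hr hs' isT; rewrite cats0.
apply: uin_last => //; first by case: (Γ1).
- move=> D Γ'' r r' hr hr' F; apply: (uin_last_inj us hr hr').
  by rewrite !(E _ Γ'') // F.
- move=> D Γ'' c nΓ'' hc.
  have hc' : has c (Γ1 ++ a :: (Γ2 ++ Γ'')) (b :: D) by move: hc; rewrite -catA.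
  have [|r hr F] := uin_last_ex us nΓ'' (D := D) (s := pre Γ1 (Γ2 ++ Γ'') t c).
    by have := has_pre ht hc'; rewrite -!catA.
  exists r => //; apply: (et _ _ _ _ _ _ hc').
    by have := has_last hs hr; rewrite -!catA.
  by rewrite -(E _ Γ'').
Qed.

(** * Right homs along an invertible 1-cell are universal at the output *)

(** Universality of [l] at [u] makes cutting with [h] bijective on cells
    [i,u -> u]; a preimage of [l], transported along [l], is a one-sided inverse
    of [h]. *)
Lemma epi_of_uin i u l h : funital -> ldiv i u u l -> has h [:: u] [:: u] ->
  uin [:: i] u [::] u (pre [::] [::] l h) -> epi u h.
Proof.
move=> un [[hl el sl] ul] hh uh.
have [j hj [jl jr]] := un u.
have [k hk Ek] := uin_last_ex uh (D := [::]) (Γ' := [:: u]) isT hl.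
have hkl : has (pre [:: i] [::] k l) [:: i; u] [:: u].
  exact: (has_pre (Γ1 := [:: i]) (Γ2 := [::]) hk hl).
have [k' hk' Ek'] := sl [::] [::] [:: u] _ hkl.
have Ekh : pre [::] [::] k' h = j.
  apply: (el [::] [::] [:: u]) => //.
    exact: (has_pre (Γ1 := [::]) (Γ2 := [::]) hk' hh).
  rewrite (jr [:: i; u] [::] [::] l hl : pre [::] [::] l j = l).
  rewrite -(pre_pre (Γ1 := [::]) (Γ2 := [::]) (Γ1' := [::]) (Γ2' := [::]) hl hk' hh).
  rewrite Ek'.
  rewrite (pre_pre (Γ1 := [:: i]) (Γ2 := [::]) (Γ1' := [::]) (Γ2' := [::]) hk hl hh).
  by rewrite -[RHS]Ek.
apply: (epi_cancel (Γ1 := [::]) (Γ2 := [::]) hk' hh).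
rewrite Ekh => Γ1 Γ2 Δ r r' hr hr'.
by rewrite (jl _ _ _ _ hr) (jl _ _ _ _ hr').
Qed.

Section Inverse.

Variables (e e' ix iy : edge M) (p q : cell M).
Hypotheses (un : funital).
Hypotheses (up : uout [:: e; e'] ix p) (uq : uout [:: e'; e] iy q).

(** The endocell [h] measures the failure of a triangle identity between [p]
    and [q].  It is cancellable because [lu] followed by [h] is universal at
    [u], as one sees by comparing the two ways to reduce [e,e',e,u] to [a]. *)
Lemma uout_of_uin a u la lu t : ldiv ix a a la -> ldiv iy u u lu ->
  uin [:: e] u [::] a t -> uout [:: e; u] a t.
Proof.
move=> [ula ila] dlu ut; have [ulu ilu] := dlu.
have [ht _ _] := ut; have [hla _ _] := ula; have [hlu elu _] := ulu.
have [hp _ _] := up; have [hq eq _] := uq.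
have uP : uout [:: e; e'; a] a (pre [::] [:: a] p la).
  exact: (uout_comp (Γ1 := [::]) (Γ2 := [:: a]) up ula).
have [hP _ _] := uP.
have [w hw Ew] := uin_last_ex ut (D := [::]) (Γ' := [:: e'; a]) isT hP.
have hf : has (pre [:: e'] [::] t w) [:: e'; e; u] [:: u].
  exact: (has_pre (Γ1 := [:: e']) (Γ2 := [::]) ht hw).
have um : uout [:: e'; e; u] u (pre [::] [:: u] q lu).
  exact: (uout_comp (Γ1 := [::]) (Γ2 := [:: u]) uq ulu).
have [hm em sm] := um.
have [h hh Eh] := sm [::] [::] [:: u] _ hf.
(* Post-composed with [t], this cell becomes, by interchange, [t] followed by
   [la], precomposed with [p]. *)
have uf : uin [:: e'; e] u [::] u (pre [:: e'] [::] t w).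
  apply: (uin_cancel (Γ := [:: e'; e]) (Γ' := [:: e]) _ hf ut) => //.
  rewrite (pre_pre (Γ1 := [:: e']) (Γ2 := [::]) (Γ1' := [:: e]) (Γ2' := [::]) ht hw ht).
  rewrite (Ew : pre [:: e] [::] w t = _).
  have -> : pre [:: e; e'] [::] t (pre [::] [:: a] p la) =
            pre [::] [:: e; u] p (pre [:: ix] [::] t la).
    exact: (pre_fork_l (Γ1 := [::]) (Γ2 := [::]) (Γ3 := [::]) hp ht hla isT).
  apply: (uin_pre (Γ1 := [::]) (Γ2 := [:: e]) up).
  exact: (uin_comp (Γ := [:: e]) (Γ' := [:: ix]) _ ut ila).
have hlh : has (pre [::] [::] lu h) [:: iy; u] [:: u].
  exact: (has_pre (Γ1 := [::]) (Γ2 := [::]) hlu hh).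
have ulh : uin [:: iy] u [::] u (pre [::] [::] lu h).
  apply: (uin_pre_cancel (Γ1 := [::]) (Γ2 := [::]) uq hlh).
  rewrite -(pre_pre (Γ1 := [::]) (Γ2 := [:: u]) (Γ1' := [::]) (Γ2' := [::]) hq hlu hh).
  by rewrite Eh.
have eh : epi u h := epi_of_uin un dlu hh ulh.
have ew : epi u w.
  apply: (epi_cancel (Γ1 := [:: e']) (Γ2 := [::]) ht hw); rewrite -Eh.
  exact: (epi_comp (Γ1 := [::]) (Γ2 := [::]) hm hh em eh).
apply: (uout_cancel (Γ1 := [:: e]) (Γ2 := [::]) hw ht ew).
by rewrite /pre Ew.
Qed.

End Inverse.

(** The witness is the transpose of [e',e,a -> a] across the right hom [t]; both
    of these are universal at their last input, hence so is the transpose. *)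
Lemma uin_transpose e e' iy q a la v t :
  uout [:: e'; e] iy q -> ldiv iy a a la -> uin [:: e'] v [::] a t ->
  exists w, uin [:: e] a [::] v w.
Proof.
move=> uq [ula ila] ut.
have uP : uin [:: e'; e] a [::] a (pre [::] [:: a] q la).
  exact: (uin_pre (Γ1 := [::]) (Γ2 := [::]) uq ila).
have [hP _ _] := uP.
have [w hw Ew] := uin_last_ex ut (D := [::]) (Γ' := [:: e; a]) isT hP.
exists w; apply: (uin_cancel (Γ := [:: e]) (Γ' := [:: e']) _ hw ut) => //.
by rewrite /pre Ew.
Qed.

(** * Tensor left universality of a weakly invertible 1-cell *)

Definition left_universal e :=
  (forall a, esrc a = esrc e ->
     exists u t, [/\ esrc u = etgt e, etgt u = etgt a & ldiv e u a t]) /\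
  (forall a, esrc a = etgt e ->
     exists v t, [/\ esrc v = esrc e, etgt v = etgt a & ldiv e a v t]).

Lemma left_universal_of_inverse x y e e' ix iy p q :
  funital -> rclosed -> esrc e = x -> etgt e = y -> esrc e' = y -> etgt e' = x ->
  tunit x ix -> tunit y iy ->
  uout [:: e; e'] ix p -> uout [:: e'; e] iy q -> left_universal e.
Proof.
move=> un rc se te se' te' [six tix lx _] [siy tiy ly _] up uq; split=> a sa.
- have [u [t [su tu ut]]] := rc e a (esym sa).
  exists u, t; split=> //; split=> //.
  have [la dla] := lx a (etrans sa se).
  have [lu dlu] := ly u (etrans su te).
  exact: (uout_of_uin un up uq dla dlu ut).
- have [v [t [sv tv ut]]] := rc e' a (etrans se' (esym (etrans sa te))).
  have [la dla] := ly a (etrans sa te).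
  have [w uw] := uin_transpose uq dla ut.
  exists v, w; split=> //; first by rewrite sv te' se.
  split=> //.
  have [lv dlv] := lx v (etrans sv te').
  exact: (uout_of_uin un up uq dlv dla uw).
Qed.

(** Right homs move the first input of a cell to its first output.  Repeating
    this removes all the inputs to the left of the place where [t] is cut. *)
Lemma uout_of_leftmost Γ a t : rclosed -> has t Γ [:: a] ->
  (forall Γ2 Δ r r', has r (a :: Γ2) Δ -> has r' (a :: Γ2) Δ ->
     pre [::] Γ2 t r = pre [::] Γ2 t r' -> r = r') ->
  (forall Γ2 Δ s, has s (Γ ++ Γ2) Δ ->
     exists2 r, has r (a :: Γ2) Δ & pre [::] Γ2 t r = s) -> uout Γ a t.
Proof.
move=> rc ht it st.
have hom c g Γ1 Δ : has c (g :: Γ1) Δ -> exists d D u k,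
    Δ = d :: D /\ uin [:: g] u [::] d k.
  move=> [dc cc]; have [_] := cell_boundary c; rewrite dc cc.
  case: Δ cc => // d D _ _ [x [y [[sg _] [sd _]]]].
  have [u [k [_ _ uk]]] := rc g d (etrans sg (esym sd)).
  by exists d, D, u, k.
have E Γ1 Γ2 g d u D k r : has k [:: g; u] [:: d] ->
    has r (Γ1 ++ a :: Γ2) (u :: D) ->
    comp [:: g] [::] [::] D (pre Γ1 Γ2 t r) k =
    pre (g :: Γ1) Γ2 t (comp [:: g] [::] [::] D r k).
  move=> hk hr.
  have := comp_pre (Δ1 := [::]) (Γ1' := [:: g]) (Γ2' := [::]) ht hr hk isT isT.
  by rewrite !cats0.
split=> //.
- elim=> [|g Γ1 IH] Γ2 Δ r r' hr hr'; first exact: (it _ _ _ _ hr hr').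
  have [d [D [u [k [ED uk]]]]] := hom r g _ _ hr; subst Δ.
  have [hk _ _] := uk.
  have nn : ~~ nilp (Γ1 ++ a :: Γ2) by case: (Γ1).
  have [r1 hr1 <-] := uin_last_ex uk nn hr.
  have [r2 hr2 <-] := uin_last_ex uk nn hr'.
  rewrite -(E _ _ _ _ _ _ _ _ hk hr1) -(E _ _ _ _ _ _ _ _ hk hr2) => F.
  congr (comp _ _ _ _ _ _); apply: (IH _ _ _ _ hr1 hr2).
  exact: (uin_last_inj uk (has_pre ht hr1) (has_pre ht hr2) F).
- elim=> [|g Γ1 IH] Γ2 Δ s hs; first exact: (st _ _ _ hs).
  have [d [D [u [k [ED uk]]]]] := hom s g _ _ hs; subst Δ.
  have [hk _ _] := uk.
  have nn : ~~ nilp (Γ1 ++ Γ ++ Γ2).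
    by move: (nilp_dom ht); case: (Γ) => // ? ?; case: (Γ1).
  have [s' hs' <-] := uin_last_ex uk nn hs.
  have [r hr <-] := IH _ _ _ hs'.
  exists (comp [:: g] [::] [::] D r k); last by rewrite (E _ _ _ _ _ _ _ _ hk hr).
  exact: (has_last (Γ := [:: g]) hk hr).
Qed.

(** * The tensor unit at the target of a tensor universal 1-cell *)

Section Unit.

Variables (e i : edge M) (ρ : cell M).
Hypothesis uρ : uout [:: e; i] e ρ.

Let hρ : has ρ [:: e; i] [:: e]. Proof. by case: uρ. Qed.

(** The equation says that [e,i,a -> v] does not depend on whether [i] is
    absorbed by [e], through [ρ], or by [a], through [l]. *)
Definition lunitor a l := has l [:: i; a] [:: a] /\
  exists v c, ldiv e a v c /\ pre [:: e] [::] l c = pre [::] [:: a] ρ c.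

Definition runitor b r := has r [:: b; i] [:: b] /\
  exists u c, rdiv u e b c /\ pre [::] [:: i] c r = pre [:: u] [::] ρ c.

Lemma lunitor_ex a v c : ldiv e a v c -> exists l, lunitor a l.
Proof.
move=> dc; have [uc ic] := dc; have [hc _ _] := uc.
have h : has (pre [::] [:: a] ρ c) [:: e; i; a] [:: v].
  exact: (has_pre (Γ1 := [::]) (Γ2 := [:: a]) hρ hc).
have [l hl E] := uin_last_ex ic (D := [::]) (Γ' := [:: i; a]) isT h.
by exists l; split=> //; exists v, c.
Qed.

Lemma lunitor_uin a l : lunitor a l -> uin [:: i] a [::] a l.
Proof.
move=> [hl [v [c [[uc ic] E]]]].
apply: (uin_cancel (Γ := [:: i]) (Γ' := [:: e]) _ hl ic) => //.
by rewrite E; apply: (uin_pre (Γ1 := [::]) (Γ2 := [::]) uρ).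
Qed.

(** Both sides agree after cutting with the division cell [e,d -> v], by which
    cells into [d] can be cancelled: there [la] and [ld] both become [ρ]. *)
Lemma lunitor_natural a d la ld Γ D r : lunitor a la -> lunitor d ld ->
  has r (a :: Γ) (d :: D) ->
  pre [::] Γ la r = comp [:: i] [::] [::] D r ld.
Proof.
move=> [hla [va [ca [[uca _] Ea]]]] [hld [vd [cd [[ucd icd] Ed]]]] hr.
have [hca _ sca] := uca; have [hcd _ _] := ucd.
apply: (uin_last_inj icd (Γ' := [:: i, a & Γ]) (D := D)).
- exact: (has_pre (Γ1 := [::]) hla hr).
- exact: (has_last (Γ := [:: i]) hld hr).
have hz : has (comp [:: e] [::] [::] D r cd) [:: e, a & Γ] (vd :: D).
  exact: (has_last (Γ := [:: e]) hcd hr).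
have [r' hr' Er'] := sca [::] Γ _ _ hz.
have -> : comp [:: e] [::] [::] D (pre [::] Γ la r) cd =
          pre [:: e] Γ la (comp [:: e] [::] [::] D r cd).
  have := comp_pre (Γ1 := [::]) (Γ1' := [:: e]) (Γ2' := [::]) (Δ1 := [::])
            hla hr hcd isT isT.
  by rewrite !cats0.
rewrite -Er'.
have -> : pre [:: e] Γ la (pre [::] Γ ca r') = pre [::] Γ (pre [:: e] [::] la ca) r'.
  by rewrite (pre_pre (Γ1 := [:: e]) (Γ2 := [::]) (Γ1' := [::]) (Γ2' := Γ) hla hca hr').
rewrite Ea (pre_pre (Γ1 := [::]) (Γ2 := [:: a]) (Γ1' := [::]) (Γ2' := Γ) hρ hca hr') Er'.
rewrite (comp_comp (Γ1 := [:: i]) (Γ2 := [::]) (Γ1' := [:: e]) (Γ2' := [::])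
           (Δ1 := [::]) hr hld hcd isT isT) Ed.
have := pre_fork_l (Γ1 := [::]) (Γ2 := [::]) (Γ3 := [::]) hρ hr hcd isT.
by rewrite /= cats0 => <-.
Qed.

Lemma runitor_ex b u c : rdiv u e b c -> exists r, runitor b r.
Proof.
move=> dc; have [uc ic] := dc; have [hc _ sc] := uc.
have h : has (pre [:: u] [::] ρ c) [:: u; e; i] [:: b].
  exact: (has_pre (Γ1 := [:: u]) (Γ2 := [::]) hρ hc).
have [r hr E] := sc [::] [:: i] [:: b] _ h.
by exists r; split=> //; exists u, c.
Qed.

Lemma runitor_uout b r : runitor b r -> uout [:: b; i] b r.
Proof.
move=> [hr [u [c [[uc ic] E]]]]; have [hc ec _] := uc.
apply: (uout_cancel (Γ1 := [::]) (Γ2 := [:: i]) hc hr ec).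
by rewrite E; apply: (uout_comp (Γ1 := [:: u]) (Γ2 := [::]) uρ).
Qed.

(** Here the comparison is made after precomposition with the division cell
    [u,e -> g], which is cancellable: both sides then become cuts with [ρ]. *)
Lemma runitor_natural g b rg rb Γ D r : runitor g rg -> runitor b rb ->
  has r (Γ ++ [:: g]) (D ++ [:: b]) ->
  pre Γ [::] rg r = comp [::] [:: i] D [::] r rb.
Proof.
move=> [hrg [ug [cg [[ucg _] Eg]]]] [hrb [ub [cb [[ucb icb] Eb]]]] hr.
have [hcg ecg _] := ucg; have [hcb _ _] := ucb; have [_ _ scb] := icb.
have hy : has (pre Γ [::] cg r) (Γ ++ [:: ug; e]) (D ++ [:: b]).
  exact: (has_pre (Γ2 := [::]) hcg hr).
have hry : has (comp [::] [:: i] D [::] r rb) (Γ ++ [:: g; i]) (D ++ [:: b]).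
  have := has_comp (Γ1 := [::]) (Γ2 := [:: i]) hr hrb isT isT.
  by rewrite /= -catA.
apply: (ecg Γ [:: i] (D ++ [:: b])) => //.
  exact: (has_pre (Γ2 := [::]) hrg hr).
have hrg' : has rg ([::] ++ g :: [:: i]) [:: g] by [].
have := pre_pre (Γ1' := Γ) (Γ2' := [::]) hcg hrg' hr; rewrite cats0 => <-.
rewrite Eg (pre_pre (Γ1 := [:: ug]) (Γ2 := [::]) hρ hcg hr).
have [||r' hr' Er'] := scb D [::] (Γ ++ [:: ug]) (pre Γ [::] cg r) isT isT.
- by case: (Γ).
- by move: hy; rewrite /= -catA; exact.
rewrite -(comp_pre (Γ1' := [::]) (Γ2' := [:: i]) (Γ2 := [::]) hcg hr hrb isT isT).
rewrite -Er'.
rewrite (comp_comp (Γ1 := [::]) (Γ2 := [:: e]) (Γ1' := [::]) (Γ2' := [:: i]) hr' hcb hrb isT isT).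
rewrite /= Eb.
have := pre_fork_r (Γ1 := [::]) (Γ2 := [::]) (Γ3 := [::]) hr' hρ hcb isT.
by rewrite /= !cats0.
Qed.

(** Naturality exchanges cutting with [l] at an input and at an output, and
    likewise for [r]: the universal property known for one unitor gives the
    missing one for another, at the far end of the cell being factored. *)
Lemma tunit_of_runitor_cell : rclosed -> esrc i = etgt e -> etgt i = etgt e ->
  (forall a, esrc a = etgt e -> exists v c, ldiv e a v c) ->
  (forall b, etgt b = etgt e -> exists u c, rdiv u e b c) -> tunit (etgt e) i.
Proof.
move=> rc si ti L R.
have exl a : esrc a = etgt e -> exists l, lunitor a l.
  by move=> /L [v [c dc]]; exact: lunitor_ex dc.
have exr b : etgt b = etgt e -> exists r, runitor b r.
  by move=> /R [v [c dc]]; exact: runitor_ex dc.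
split=> // [a sa|b tb].
- have [l nl] := exl a sa; exists l; split; last exact: lunitor_uin nl.
  have [hl _] := nl.
  have cod_edge c g Γ Δ : has c (g :: Γ) Δ -> esrc g = etgt e ->
      exists d D ld, Δ = d :: D /\ lunitor d ld.
    move=> [dc cc] sg; have [_] := cell_boundary c; rewrite dc cc.
    case: Δ cc => // d D _ _ [x [y [[sg' _] [sd _]]]].
    have [ld nd] := exl d (etrans sd (etrans (esym sg') sg)).
    by exists d, D, ld.
  apply: uout_of_leftmost => // Γ Δ.
  + move=> r r' hr hr'; have [d [D [ld [ED nd]]]] := cod_edge r _ _ _ hr sa.
    subst Δ; rewrite (lunitor_natural nl nd hr) (lunitor_natural nl nd hr').
    exact: (uin_last_inj (lunitor_uin nd) hr hr').
  + move=> s hs; have [d [D [ld [ED nd]]]] := cod_edge s _ _ _ hs si; subst Δ.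
    have [r hr <-] := uin_last_ex (lunitor_uin nd) (Γ' := a :: Γ) isT hs.
    by exists r => //; exact: lunitor_natural nl nd hr.
- have [r nr] := exr b tb; exists r; split; first exact: runitor_uout nr.
  have [hr _] := nr.
  have pl Δ2 : planar [:: i] Δ2 -> Δ2 = [::] by case: Δ2.
  have dom_edge s Γ Δ : ~~ nilp Γ -> has s (Γ ++ [:: i]) Δ ->
      exists Γ' g rg, Γ = Γ' ++ [:: g] /\ runitor g rg.
    case/lastP: Γ => // Γ' g _ [ds _]; have [_ _] := cell_boundary s.
    rewrite ds => -[x [y [C _]]].
    have [rg ng] : exists rg, runitor g rg.
      apply: exr; rewrite -si; move: C {ds}; rewrite -cats1 -catA /=.
      by elim: Γ' x => [|g' Γ' IH] x /= [_]; [case=> -> | exact: IH].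
    by exists Γ', g, rg; rewrite cats1.
  split=> // Δ1 Δ2 Γ.
  + move=> s s' _ /pl -> hs hs' E.
    have nΓ := nilp_dom hs.
    have [Γ' [g [rg [EΓ ng]]]] := dom_edge _ Γ _ nΓ
      (has_comp (Γ1 := [::]) (Γ2 := [:: i]) hs hr isT isT).
    subst Γ; have [_ erg _] := runitor_uout ng.
    apply: (erg _ [::] _ _ _ hs hs').
    by rewrite (runitor_natural ng nr hs) (runitor_natural ng nr hs').
  + move=> s _ /pl -> nΓ hs.
    have [Γ' [g [rg [EΓ ng]]]] := dom_edge s Γ _ nΓ hs; subst Γ.
    have [_ _ srg] := runitor_uout ng.
    have [|s' hs' <-] := srg Γ' [::] (Δ1 ++ [:: b]) s.
      by move: hs; rewrite /= -catA.
    by exists s' => //; rewrite (runitor_natural ng nr hs').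
Qed.

End Unit.

(** The monoid argument [e1 = (e2 e) e1 = e2 (e e1) = e2]: the two ways to
    reduce [e2,e,e1] differ by a cell [k : e1 -> e2] universal at its output. *)
Lemma uout_inverse e e1 e2 ix iy p q : ldiv e e1 ix p -> rdiv e2 e iy q ->
  (exists l, ldiv iy e1 e1 l) -> (exists r, rdiv e2 ix e2 r) ->
  exists q', uout [:: e1; e] iy q'.
Proof.
move=> [up _] [uq _] [l [ul _]] [r [ur _]].
have uA : uout [:: e2; e; e1] e2 (pre [:: e2] [::] p r).
  exact: (uout_comp (Γ1 := [:: e2]) (Γ2 := [::]) up ur).
have uB : uout [:: e2; e; e1] e1 (pre [::] [:: e1] q l).
  exact: (uout_comp (Γ1 := [::]) (Γ2 := [:: e1]) uq ul).
have [hA _ _] := uA; have [hB eB sB] := uB.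
have [k hk Ek] := sB [::] [::] [:: e2] _ hA.
have uk : uout [:: e1] e2 k.
  by apply: (uout_cancel (Γ1 := [::]) (Γ2 := [::]) hB hk eB); rewrite Ek.
exists (pre [::] [:: e] k q).
exact: (uout_comp (Γ1 := [::]) (Γ2 := [:: e]) uk uq).
Qed.

End Flat.

(** * Left-right symmetry *)

Lemma composable_cat T0 T1 (f g : T1 -> T0) x Γ Γ' y :
  composable f g x (Γ ++ Γ') y <->
  exists z, composable f g x Γ z /\ composable f g z Γ' y.
Proof.
elim: Γ x => [|a Γ IH] x /=; first by split=> [h|[z [->]] //]; exists x.
split=> [[sa /IH [z [h h']]]|[z [[sa h] h']]]; first by exists z.
by split=> //; apply/IH; exists z.
Qed.

Lemma composable_rev T0 T1 (f g : T1 -> T0) x Γ y :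
  composable f g x Γ y -> composable g f y (rev Γ) x.
Proof.
elim: Γ x => [|a Γ IH] x /=; first by move=> ->.
move=> [sa /IH h]; rewrite rev_cons -cats1; apply/composable_cat.
by exists (g a).
Qed.

Section Mirror.

Variable M : flat_poly.

Lemma mirror_boundary (c : cell M) :
  [/\ ~~ nilp (rev (dom c)), ~~ nilp (rev (cod c)) &
    exists x y, composable (@etgt M) (@esrc M) x (rev (dom c)) y /\
                composable (@etgt M) (@esrc M) x (rev (cod c)) y].
Proof.
have [nd nc [x [y [hd hc]]]] := cell_boundary c.
split; rewrite ?/nilp ?size_rev //; exists y, x.
by split; apply: composable_rev.
Qed.

Lemma rev_eq T (Γ Γ' : seq T) : rev Γ = Γ' -> Γ = rev Γ'.
Proof. by move=> <-; rewrite revK. Qed.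

(* [comp] already names positions by the surrounding lists, so that reversing
   those is all that symmetry requires. *)
Let rcomp Γ1 Γ2 Δ1 Δ2 (t s : cell M) :=
  comp (rev Γ2) (rev Γ1) (rev Δ2) (rev Δ1) t s.

Definition mirror : flat_poly.
Proof.
refine (@FlatPoly (obj M) (edge M) (@etgt M) (@esrc M) (cell M)
  (fun c => rev (dom c)) (fun c => rev (cod c)) rcomp mirror_boundary _ _ _).
- move=> Γ1 Γ2 Δ1 Δ2 a t s /rev_eq ct /rev_eq ds h1 h2.
  rewrite rev_cat rev_cons cat_rcons in ct; rewrite rev_cat rev_cons cat_rcons in ds.
  rewrite -(planar_rev Γ1) in h1; rewrite -(planar_rev Γ2) in h2.
  have [-> ->] := comp_boundary ct ds h2 h1.
  by rewrite !rev_cat !revK -!catA.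
- move=> Γ1 Γ2 Γ1' Γ2' Δ1 Δ2 Δ1' Δ2' a b t s r /rev_eq ct /rev_eq ds /rev_eq cs
    /rev_eq dr.
  rewrite !(rev_cat, rev_cons, cat_rcons) in ct ds cs dr.
  rewrite -(planar_rev Γ1 Δ1) -(planar_rev Γ2 Δ2) -(planar_rev Γ1') -(planar_rev Γ2').
  rewrite -(planar_rev Γ1' (Δ1 ++ _)) -(planar_rev Γ2' (_ ++ Δ2)).
  rewrite -(planar_rev (_ ++ Γ1)) -(planar_rev (Γ2 ++ _)) /rcomp !rev_cat.
  move=> *; exact: (comp_chain ct ds cs dr).
- move=> Γ1 Γ2 Γ3 Δ1 Δ2 Δ1' Δ2' a b t s r /rev_eq dr /rev_eq ct /rev_eq cs.
  rewrite !(rev_cat, rev_cons, cat_rcons, =^~ catA) in dr ct cs.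
  rewrite -(planar_rev Γ1 Δ1) -(planar_rev _ Δ2) -(planar_rev _ Δ1').
  rewrite -(planar_rev Γ3) -(planar_rev _ Δ1') -(planar_rev _ Δ2).
  rewrite /rcomp !(rev_cat, rev_cons, cat_rcons, =^~ catA, revK).
  move=> *; symmetry; exact: (comp_fork dr cs ct).
Defined.

End Mirror.

Section MirrorNotions.

Variable M : flat_poly.
Let W := mirror M.
Implicit Types (Γ Δ : seq (edge M)) (a b e i u v : edge M) (t s r c : cell M).

Lemma has_mirror c Γ Δ : @has W c Γ Δ <-> @has M c (rev Γ) (rev Δ).
Proof.
by split=> -[/= d d']; split; rewrite /= -[LHS]revK ?d ?d' ?revK.
Qed.

Lemma uout_mirror Γ a t : @uout W Γ a t <-> @uout M (rev Γ) a t.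
Proof.
split=> -[ht et st]; split=> //.
- by move/has_mirror: ht.
- move=> Γ1 Γ2 Δ r r' hr hr' E.
  apply: (et (rev Γ2) (rev Γ1) (rev Δ)).
  + by apply/has_mirror; rewrite !(rev_cat, rev_cons, cat_rcons, revK).
  + by apply/has_mirror; rewrite !(rev_cat, rev_cons, cat_rcons, revK).
  + by rewrite /pre /= !revK.
- move=> Γ1 Γ2 Δ s hs; have [|r /has_mirror hr E] := st (rev Γ2) (rev Γ1) (rev Δ) s.
    by apply/has_mirror; rewrite !(rev_cat, revK) -catA.
  exists r; last by rewrite -E /pre /= !revK.
  by move: hr; rewrite !(rev_cat, rev_cons, cat_rcons, revK).
- by apply/has_mirror.
- move=> Γ1 Γ2 Δ r r' /has_mirror hr /has_mirror hr' E.
  rewrite !(rev_cat, rev_cons, cat_rcons) in hr hr'.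
  exact: et hr hr' E.
- move=> Γ1 Γ2 Δ s /has_mirror hs.
  rewrite !(rev_cat, =^~ catA) in hs; have [r hr E] := st _ _ _ _ hs.
  by exists r => //; apply/has_mirror; rewrite !(rev_cat, rev_cons, cat_rcons).
Qed.

Lemma uin_mirror Γ1 a Γ2 b t :
  @uin W Γ1 a Γ2 b t <-> @uin M (rev Γ2) a (rev Γ1) b t.
Proof.
split=> -[ht it st]; split.
- by move/has_mirror: ht; rewrite !(rev_cat, rev_cons, cat_rcons).
- move=> Δ1 Δ2 Γ r r'.
  rewrite -(planar_rev _ Δ1) -(planar_rev _ Δ2) !revK => h1 h2 hr hr' E.
  apply: (it (rev Δ2) (rev Δ1) (rev Γ)) => //.
  + by apply/has_mirror; rewrite !(rev_cat, rev_cons, cat_rcons, revK).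
  + by apply/has_mirror; rewrite !(rev_cat, rev_cons, cat_rcons, revK).
  + by rewrite /= !revK.
- move=> Δ1 Δ2 Γ s.
  rewrite -(planar_rev _ Δ1) -(planar_rev _ Δ2) !revK => h1 h2 nΓ hs.
  have [|||| r /has_mirror hr E] := st (rev Δ2) (rev Δ1) (rev Γ) s => //.
  + by rewrite /nilp size_rev.
  + apply/has_mirror; move: hs.
    by rewrite !(rev_cat, rev_cons, cat_rcons, revK) -!catA.
  exists r; last by rewrite -E /= !revK.
  by move: hr; rewrite !(rev_cat, rev_cons, cat_rcons, revK).
- by apply/has_mirror; move: ht; rewrite !(rev_cat, rev_cons, cat_rcons).
- move=> Δ1 Δ2 Γ r r'; rewrite -(planar_rev _ Δ1) -(planar_rev _ Δ2).
  move=> h1 h2 /has_mirror hr /has_mirror hr' E.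
  rewrite !(rev_cat, rev_cons, cat_rcons) in hr hr'.
  exact: it h2 h1 hr hr' E.
- move=> Δ1 Δ2 Γ s; rewrite -(planar_rev _ Δ1) -(planar_rev _ Δ2).
  move=> h1 h2 nΓ /has_mirror hs.
  rewrite !(rev_cat, rev_cons, cat_rcons, =^~ catA) in hs.
  have [|r hr E] := st _ _ _ _ h2 h1 _ hs; first by rewrite /nilp size_rev.
  by exists r => //; apply/has_mirror; rewrite !(rev_cat, rev_cons, cat_rcons).
Qed.

Lemma ldiv_mirror e u a t : @ldiv W e u a t <-> @rdiv M u e a t.
Proof.
split=> -[h h']; split.
- by move/uout_mirror: h.
- by move/uin_mirror: h'.
- exact/uout_mirror.
- exact/uin_mirror.
Qed.

Lemma rdiv_mirror e u a t : @rdiv W u e a t <-> @ldiv M e u a t.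
Proof.
split=> -[h h']; split.
- by move/uout_mirror: h.
- by move/uin_mirror: h'.
- exact/uout_mirror.
- exact/uin_mirror.
Qed.

Lemma tunit_mirror x i : @tunit W x i <-> @tunit M x i.
Proof.
split=> -[si ti L R]; split=> //.
- by move=> a /R [l /rdiv_mirror]; exists l.
- by move=> b /L [r /ldiv_mirror]; exists r.
- by move=> a /R [l /ldiv_mirror]; exists l.
- by move=> b /L [r /rdiv_mirror]; exists r.
Qed.

Lemma funital_mirror : @funital M -> @funital W.
Proof.
move=> un a; have [i hi [il ir]] := un a; exists i.
  by apply/has_mirror.
split.
- move=> Γ1 Γ2 Δ s /has_mirror.
  by rewrite !(rev_cat, rev_cons, cat_rcons); exact: il.
- move=> Γ Δ1 Δ2 t /has_mirror.
  by rewrite !(rev_cat, rev_cons, cat_rcons); exact: ir.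
Qed.

Definition lclosed := forall a b, etgt a = etgt b ->
  exists u t, [/\ etgt u = esrc a, esrc u = esrc b & @uin M [::] u [:: a] b t].

Lemma rclosed_mirror : lclosed -> @rclosed W.
Proof.
move=> lc a b h; have [u [t [su tu ut]]] := lc a b h.
by exists u, t; split=> //; apply/uin_mirror.
Qed.

Definition right_universal e :=
  (forall b, etgt b = etgt e ->
     exists u t, [/\ etgt u = esrc e, esrc u = esrc b & @rdiv M u e b t]) /\
  (forall b, etgt b = esrc e ->
     exists v t, [/\ etgt v = etgt e, esrc v = esrc b & @rdiv M b e v t]).

Lemma left_universal_mirror e : @left_universal W e <-> right_universal e.
Proof.
split=> -[h h']; split=> a ta.
- by have [u [t [? ? /ldiv_mirror d]]] := h a ta; exists u, t.
- by have [u [t [? ? /ldiv_mirror d]]] := h' a ta; exists u, t.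
- by have [u [t [? ? /ldiv_mirror d]]] := h a ta; exists u, t.
- by have [u [t [? ? /ldiv_mirror d]]] := h' a ta; exists u, t.
Qed.

End MirrorNotions.

Lemma right_universal_mirror (M : flat_poly) (e : edge M) :
  left_universal e -> @right_universal (mirror M) e.
Proof.
move=> [h h']; split=> a sa.
- by have [u [t [? ? /rdiv_mirror d]]] := h a sa; exists u, t.
- by have [u [t [? ? /rdiv_mirror d]]] := h' a sa; exists u, t.
Qed.

(** * Tensor universality and weak inverses, for bundled cells *)

Lemma tunit_tgt (M : flat_poly) (e : edge M) : rclosed M ->
  left_universal e -> right_universal e -> exists i, tunit (etgt e) i.
Proof.
move=> rc [L1 L2] [R1 _]; have [i [ρ [si ti [uρ _]]]] := L1 e erefl.
exists i; apply: (tunit_of_runitor_cell uρ) => //.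
- by move=> a /L2 [v [c [_ _ d]]]; exists v, c.
- by move=> b /R1 [u [c [_ _ d]]]; exists u, c.
Qed.

Lemma universal_iff_inverse (M : flat_poly) (x y : obj M) (e : edge M) :
  funital M -> rclosed M -> lclosed M -> esrc e = x -> etgt e = y ->
  left_universal e /\ right_universal e <->
  exists ix iy e' p q, [/\ tunit x ix, tunit y iy, esrc e' = y /\ etgt e' = x,
    uout [:: e; e'] ix p & uout [:: e'; e] iy q].
Proof.
move=> un rc lc <- <-; split=> [[L R]|].
- have [iy tiy] := tunit_tgt rc L R.
  have [ix /tunit_mirror tix] : exists ix, @tunit (mirror M) (esrc e) ix.
    apply: (tunit_tgt (rclosed_mirror lc)); first exact/left_universal_mirror.
    exact: right_universal_mirror.
  have [sx tx lx rx] := tix; have [sy ty ly ry] := tiy.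
  have [e1 [p [s1 t1 dp]]] := L.1 ix sx.
  have [e2 [q [t2 s2 dq]]] := R.1 iy ty.
  have [q' uq'] := uout_inverse dp dq (ly e1 s1) (rx e2 t2).
  exists ix, iy, e1, p, q'; split=> //; first by rewrite s1 t1.
  by case: dp.
- move=> [ix [iy [e' [p [q [tix tiy [se' te'] up uq]]]]]]; split.
    exact: (left_universal_of_inverse un rc erefl erefl se' te' tix tiy up uq).
  apply/left_universal_mirror.
  apply: (left_universal_of_inverse (M := mirror M) (funital_mirror un)
    (rclosed_mirror lc) (x := etgt e) (y := esrc e) erefl erefl te' se').
  + exact/tunit_mirror/tiy.
  + exact/tunit_mirror/tix.
  + exact/uout_mirror/uq.
  + exact/uout_mirror/up.
Qed.

(** * Bundling the cells of a poly-bicategory *)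

Section Flatten.

Variable X : poly_bicategory.
Implicit Types (Γ Δ : seq (cell1 X)) (a b : cell1 X).

Let fcell := {b : seq (cell1 X) * seq (cell1 X) & cell2 b.1 b.2}.
Let fdom (c : fcell) := (projT1 c).1.
Let fcod (c : fcell) := (projT1 c).2.

(** Uniqueness of identity proofs on boundaries: the 1-cells have no decidable
    equality. *)
Lemma pack_inj Γ Δ : injective (@pack X Γ Δ).
Proof. by move=> t t'; exact: inj_pair2. Qed.

Lemma packP (c : fcell) Γ Δ : fdom c = Γ -> fcod c = Δ ->
  exists t : cell2 Γ Δ, c = pack t.
Proof. by case: c => -[Γ' Δ'] t /= <- <-; exists t. Qed.

Lemma cod_pack (c : fcell) Δ : fcod c = Δ ->
  exists Γ (t : cell2 Γ Δ), c = pack t.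
Proof. by case: c => -[Γ Δ'] t /= <-; exists Γ, t. Qed.

Lemma dom_pack (c : fcell) Γ : fdom c = Γ ->
  exists Δ (t : cell2 Γ Δ), c = pack t.
Proof. by case: c => -[Γ' Δ] t /= <-; exists Δ, t. Qed.

(** A relation, because choosing the boundaries at which two bundled cells can
    be cut amounts to deciding equality of 1-cells. *)
Definition is_cut Γ1 Γ2 Δ1 Δ2 (t s c : fcell) : Prop :=
  exists Γ Δ a (h1 : planar Γ1 Δ1) (h2 : planar Γ2 Δ2)
    (t0 : cell2 Γ (Δ1 ++ a :: Δ2)) (s0 : cell2 (Γ1 ++ a :: Γ2) Δ),
  [/\ t = pack t0, s = pack s0 & c = pack (cut h1 h2 t0 s0)].

Definition fcut Γ1 Γ2 Δ1 Δ2 (t s : fcell) : fcell :=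
  epsilon (inhabits t) (is_cut Γ1 Γ2 Δ1 Δ2 t s).

(** The boundaries, and hence the operands of [cut], are determined by the
    bundled cells and the lists around the common 1-cell. *)
Lemma fcutE Γ Γ1 Γ2 Δ Δ1 Δ2 a (h1 : planar Γ1 Δ1) (h2 : planar Γ2 Δ2)
    (t : cell2 Γ (Δ1 ++ a :: Δ2)) (s : cell2 (Γ1 ++ a :: Γ2) Δ) :
  fcut Γ1 Γ2 Δ1 Δ2 (pack t) (pack s) = pack (cut h1 h2 t s).
Proof.
have : is_cut Γ1 Γ2 Δ1 Δ2 (pack t) (pack s) (fcut Γ1 Γ2 Δ1 Δ2 (pack t) (pack s)).
  by apply: epsilon_spec; exists (pack (cut h1 h2 t s)), Γ, Δ, a, h1, h2, t, s.
move=> [Γ' [Δ' [a' [k1 [k2 [t' [s' [Et Es ->]]]]]]]].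
have EΓ : Γ' = Γ by have := congr1 fdom Et.
have EΔ : Δ' = Δ by have := congr1 fcod Es.
have Ea : a' = a.
  have := congr1 (drop (size Δ1)) (congr1 fcod Et).
  by rewrite /fcod /= !drop_size_cat // => -[].
subst Γ' Δ' a'; rewrite (pack_inj Et) (pack_inj Es).
by rewrite (bool_irrelevance k1 h1) (bool_irrelevance k2 h2).
Qed.

Lemma fcut_boundary Γ1 Γ2 Δ1 Δ2 a t s :
  fcod t = Δ1 ++ a :: Δ2 -> fdom s = Γ1 ++ a :: Γ2 ->
  planar Γ1 Δ1 -> planar Γ2 Δ2 ->
  fdom (fcut Γ1 Γ2 Δ1 Δ2 t s) = Γ1 ++ fdom t ++ Γ2 /\
  fcod (fcut Γ1 Γ2 Δ1 Δ2 t s) = Δ1 ++ fcod s ++ Δ2.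
Proof.
move=> /(packP erefl) [t0 ->] ds h1 h2; have [s0 ->] := packP ds erefl.
by rewrite (fcutE h1 h2).
Qed.

Lemma fcell_boundary c : [/\ ~~ nilp (fdom c), ~~ nilp (fcod c) &
  exists x y, composable (@src X) (@tgt X) x (fdom c) y /\
              composable (@src X) (@tgt X) x (fcod c) y].
Proof. by case: c => -[Γ Δ] t; exact: cell2_boundary t. Qed.

Lemma fcut_chain Γ1 Γ2 Γ1' Γ2' Δ1 Δ2 Δ1' Δ2' a b t s r :
  fcod t = Δ1 ++ a :: Δ2 -> fdom s = Γ1 ++ a :: Γ2 ->
  fcod s = Δ1' ++ b :: Δ2' -> fdom r = Γ1' ++ b :: Γ2' ->
  planar Γ1 Δ1 -> planar Γ2 Δ2 -> planar Γ1' Δ1' -> planar Γ2' Δ2' ->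
  planar Γ1' (Δ1 ++ Δ1') -> planar Γ2' (Δ2' ++ Δ2) ->
  planar (Γ1' ++ Γ1) Δ1 -> planar (Γ2 ++ Γ2') Δ2 ->
  fcut Γ1' Γ2' (Δ1 ++ Δ1') (Δ2' ++ Δ2) (fcut Γ1 Γ2 Δ1 Δ2 t s) r =
  fcut (Γ1' ++ Γ1) (Γ2 ++ Γ2') Δ1 Δ2 t (fcut Γ1' Γ2' Δ1' Δ2' s r).
Proof.
move=> /(packP erefl) [t0 ->] ds cs dr h1 h2 h3 h4 h5 h6 h7 h8.
have [s0 ->] := packP ds cs; have [r0 ->] := packP dr erefl.
rewrite (fcutE h1 h2) (fcutE h3 h4).
have [||u Eu] := @packP (pack (cut h1 h2 t0 s0)) (Γ1 ++ fdom t ++ Γ2)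
  ((Δ1 ++ Δ1') ++ b :: (Δ2' ++ Δ2)) => //; first by rewrite /fcod /= -!catA.
have [||v Ev] := @packP (pack (cut h3 h4 s0 r0))
  ((Γ1' ++ Γ1) ++ a :: (Γ2 ++ Γ2')) (Δ1' ++ fcod r ++ Δ2') => //.
  by rewrite /fdom /= -!catA.
rewrite Eu Ev (fcutE h5 h6) (fcutE h7 h8).
exact: cut_chain (esym Eu) (esym Ev).
Qed.

Lemma fcut_fork Γ1 Γ2 Γ3 Δ1 Δ2 Δ1' Δ2' a b t s r :
  fdom r = Γ1 ++ a :: Γ2 ++ b :: Γ3 ->
  fcod t = Δ1 ++ a :: Δ2 -> fcod s = Δ1' ++ b :: Δ2' ->
  planar Γ1 Δ1 -> planar (Γ2 ++ b :: Γ3) Δ2 ->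
  planar (Γ1 ++ fdom t ++ Γ2) Δ1' -> planar Γ3 Δ2' ->
  planar (Γ1 ++ a :: Γ2) Δ1' -> planar (Γ2 ++ fdom s ++ Γ3) Δ2 ->
  fcut (Γ1 ++ fdom t ++ Γ2) Γ3 Δ1' Δ2' s
    (fcut Γ1 (Γ2 ++ b :: Γ3) Δ1 Δ2 t r) =
  fcut Γ1 (Γ2 ++ fdom s ++ Γ3) Δ1 Δ2 t
    (fcut (Γ1 ++ a :: Γ2) Γ3 Δ1' Δ2' s r).
Proof.
move=> /dom_pack [Δ [r0 ->]] /cod_pack [Γt [t0 ->]] /cod_pack [Γs [s0 ->]].
move=> h1 h2 h3 h4 h5 h6.
have [||r1 Er1] := @packP (pack r0) ((Γ1 ++ a :: Γ2) ++ b :: Γ3) Δ => //.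
  by rewrite /fdom /= -catA.
have [||u Eu] := @packP (pack (cut h1 h2 t0 r0))
  ((Γ1 ++ Γt ++ Γ2) ++ b :: Γ3) (Δ1 ++ Δ ++ Δ2) => //.
  by rewrite /fdom /= -!catA.
have [||v Ev] := @packP (pack (cut h5 h4 s0 r1))
  (Γ1 ++ a :: (Γ2 ++ Γs ++ Γ3)) (Δ1' ++ Δ ++ Δ2') => //.
  by rewrite /fdom /= -!catA.
rewrite (fcutE h1 h2) Eu (fcutE h3 h4) Er1 (fcutE h5 h4) Ev (fcutE h1 h6).
exact: cut_fork_in (esym Er1) (esym Eu) (esym Ev).
Qed.

Definition flat : flat_poly :=
  FlatPoly fcell_boundary fcut_boundary fcut_chain fcut_fork.

Lemma hasP (c : cell flat) Γ Δ : has c Γ Δ -> exists t : cell2 Γ Δ, c = pack t.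
Proof. by case=> d d'; exact: packP. Qed.

Lemma universal_outP Γ a (t : cell2 Γ [:: a]) :
  @universal_out X Γ [::] a [::] t <-> @uout flat Γ a (pack t).
Proof.
split=> [ut|[_ et st] Γ1 Γ2 Δ h1 h2 nΔ s].
- split=> // [Γ1 Γ2 Δ r r' /hasP [r0 ->] /hasP [r0' ->]|Γ1 Γ2 Δ s hs].
  + rewrite /pre /= !(fcutE (planar0r _) (planar0r _)) => /pack_inj E.
    have [_ nΔ _] := cell2_boundary r0.
    have [r1 [_ U]] := ut _ _ _ (planar0r Γ1) (planar0r Γ2) nΔ
      (cut (planar0r _) (planar0r _) t r0).
    by rewrite -(U r0) // -(U r0').
  + have [s0 Es] := @packP s (Γ1 ++ Γ ++ Γ2) ([::] ++ Δ ++ [::]) hs.1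
      (etrans hs.2 (esym (cats0 Δ))).
    have nΔ : ~~ nilp Δ by rewrite -hs.2; case: (cell_boundary s).
    have [r [Er _]] := ut _ _ _ (planar0r Γ1) (planar0r Γ2) nΔ s0.
    exists (pack r) => //.
    by rewrite /pre /= (fcutE (planar0r _) (planar0r _)) Es Er.
- have hs : @has flat (pack s) (Γ1 ++ Γ ++ Γ2) Δ.
    by split=> //; rewrite /= /fcod /= cats0.
  have [_ /hasP [r ->]] := st _ _ _ _ hs.
  rewrite /pre /= (fcutE h1 h2) => /pack_inj Er.
  exists r; split=> // r' Er'; apply: pack_inj; apply: (et Γ1 Γ2 Δ) => //.
  by rewrite /pre /= !(fcutE h1 h2) Er -Er'.
Qed.

Lemma universal_inP Γ1 a Γ2 b (t : cell2 (Γ1 ++ a :: Γ2) [:: b]) :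
  @universal_in X [:: b] Γ1 a Γ2 t <-> @uin flat Γ1 a Γ2 b (pack t).
Proof.
split=> [ut|[_ it st] Δ1 Δ2 Γ h1 h2 nΓ s].
- split=> // [Δ1 Δ2 Γ r r' h1 h2 /hasP [r0 ->] /hasP [r0' ->]|].
  + rewrite /= !(fcutE h1 h2) => /pack_inj E.
    have [nΓ _ _] := cell2_boundary r0.
    have [r1 [_ U]] := ut _ _ _ h1 h2 nΓ (cut h1 h2 r0 t).
    by rewrite -(U r0) // -(U r0').
  + move=> Δ1 Δ2 Γ s h1 h2 nΓ /hasP [s0 ->].
    have [r [Er _]] := ut _ _ _ h1 h2 nΓ s0.
    by exists (pack r) => //; rewrite /= (fcutE h1 h2) Er.
- have [//|_ /hasP [r ->]] := st Δ1 Δ2 Γ (pack s) h1 h2 nΓ.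
  rewrite /= (fcutE h1 h2) => /pack_inj Er.
  exists r; split=> // r' Er'; apply: pack_inj; apply: (it Δ1 Δ2 Γ) => //.
  by rewrite /= !(fcutE h1 h2) Er -Er'.
Qed.

Lemma left_divP e u a :
  (exists t : cell2 [:: e; u] [:: a], left_div t) <->
  (exists t, @ldiv flat e u a t).
Proof.
split=> [[t [ho hi]]|[c dc]].
- by exists (pack t); split; [exact/universal_outP|exact/(universal_inP (Γ1 := [:: e]))].
- have [[/hasP [t Et] _ _] _] := dc; subst c; have [ho hi] := dc.
  by exists t; split; [exact/universal_outP|exact/(universal_inP (Γ1 := [:: e]))].
Qed.

Lemma right_divP u e a :
  (exists t : cell2 [:: u; e] [:: a], right_div t) <->
  (exists t, @rdiv flat u e a t).
Proof.
split=> [[t [ho hi]]|[c dc]].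
- by exists (pack t); split; [exact/universal_outP|exact/(universal_inP (Γ1 := [::]))].
- have [[/hasP [t Et] _ _] _] := dc; subst c; have [ho hi] := dc.
  by exists t; split; [exact/universal_outP|exact/(universal_inP (Γ1 := [::]))].
Qed.

Lemma tensor_unitP (x : cell0 X) i : tensor_unit x i <-> @tunit flat x i.
Proof.
split=> [[[si ti] L R]|[si ti L R]]; split=> //.
- by move=> a sa; apply/left_divP; exact: (L (tgt a)).
- by move=> b tb; apply/right_divP; exact: (R (src b)).
- by move=> y a [sa _]; apply/left_divP; exact: L.
- by move=> z b [_ tb]; apply/right_divP; exact: R.
Qed.

Lemma tensor_left_universalP (e : cell1 X) :
  tensor_left_universal e <-> @left_universal flat e.
Proof.
split=> -[L1 L2]; split.
- move=> a sa; have [|u [t [[su tu] d]]] := L1 (tgt a) a; first by split.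
  have [c dc] := (left_divP e u a).1 (ex_intro _ t d).
  by exists u, c.
- move=> a sa; have [|u [t [[su tu] d]]] := L2 (tgt a) a; first by split.
  have [c dc] := (left_divP e a u).1 (ex_intro _ t d).
  by exists u, c.
- move=> y a [sa ta]; have [u [c [su tu d]]] := L1 a sa.
  have [t dt] := (left_divP e u a).2 (ex_intro _ c d).
  by exists u, t; split=> //; split=> //; rewrite -ta.
- move=> y a [sa ta]; have [u [c [su tu d]]] := L2 a sa.
  have [t dt] := (left_divP e a u).2 (ex_intro _ c d).
  by exists u, t; split=> //; split=> //; rewrite -ta.
Qed.

Lemma tensor_right_universalP (e : cell1 X) :
  tensor_right_universal e <-> @right_universal flat e.
Proof.
split=> -[R1 R2]; split.
- move=> b tb; have [|u [t [[su tu] d]]] := R1 (src b) b; first by split.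
  have [c dc] := (right_divP u e b).1 (ex_intro _ t d).
  by exists u, c.
- move=> b tb; have [|u [t [[su tu] d]]] := R2 (src b) b; first by split.
  have [c dc] := (right_divP b e u).1 (ex_intro _ t d).
  by exists u, c.
- move=> z b [sb tb]; have [u [c [tu su d]]] := R1 b tb.
  have [t dt] := (right_divP u e b).2 (ex_intro _ c d).
  by exists u, t; split=> //; split=> //; rewrite -sb.
- move=> z b [sb tb]; have [u [c [tu su d]]] := R2 b tb.
  have [t dt] := (right_divP b e u).2 (ex_intro _ c d).
  by exists u, t; split=> //; split=> //; rewrite -sb.
Qed.

Lemma flat_unital : unital X -> funital flat.
Proof.
move=> un a; have [i [il ir]] := un a; exists (pack i) => //; split.
- move=> Γ1 Γ2 Δ s /hasP [s0 ->].
  rewrite /pre /= (@fcutE [:: a] Γ1 Γ2 Δ [::] [::] a (planar0r _) (planar0r _)).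
  exact: il.
- move=> Γ Δ1 Δ2 t /hasP [t0 ->].
  rewrite /= (@fcutE Γ [::] [::] [:: a] Δ1 Δ2 a isT isT).
  exact: ir.
Qed.

Lemma flat_rclosed : right_1closed X -> rclosed flat.
Proof.
move=> [_ rc] a b sab.
have [||u [t [[su tu] ut]]] := rc (src a) (tgt a) (tgt b) a b; try by split.
exists u, (pack t); split=> //.
exact/(universal_inP (Γ1 := [:: a]) (Γ2 := [::])).
Qed.

Lemma flat_lclosed : left_1closed X -> lclosed flat.
Proof.
move=> [_ lc] a b tab.
have [||u [t [[su tu] ut]]] := lc (src b) (src a) (tgt a) a b; try by split.
exists u, (pack t); split=> //.
exact/(universal_inP (Γ1 := [::]) (Γ2 := [:: a])).
Qed.

End Flatten.

Theorem proposition3p18 (X : poly_bicategory)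
    (hright : right_1closed X) (hleft : left_1closed X)
    (x y : cell0 X) (e : cell1 X) (he : arrow e x y) :
  tensor_universal e <->
  exists (ux uy estar : cell1 X)
         (p : cell2 [:: e; estar] [:: ux]) (q : cell2 [:: estar; e] [:: uy]),
    [/\ tensor_unit x ux, tensor_unit y uy, arrow estar y x,
        @universal_out X [:: e; estar] [::] ux [::] p &
        @universal_out X [:: estar; e] [::] uy [::] q].
Proof.
have [se te] := he.
have main := @universal_iff_inverse (flat X) x y e (flat_unital hright.1)
  (flat_rclosed hright) (flat_lclosed hleft) se te.
split.
- move=> [/tensor_left_universalP L /tensor_right_universalP R].
  have [ux [uy [e' [c [d [tx ty ar uc ud]]]]]] := main.1 (conj L R).
  have [/hasP [p Ep] _ _] := uc; have [/hasP [q Eq] _ _] := ud; subst c d.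
  exists ux, uy, e', p, q.
  by split=> //; (exact/tensor_unitP || exact/universal_outP).
- move=> [ux [uy [e' [p [q [tx ty ar up uq]]]]]].
  have [|L R] := main.2.
    exists ux, uy, e', (pack p), (pack q).
    by split=> //; (exact/tensor_unitP || exact/universal_outP).
  by split; [exact/tensor_left_universalP|exact/tensor_right_universalP].
Qed.
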